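(* Let $\{d_p\}_{p\in\mathbb{N}}$ be a regular family of metrics in the Infinite Grassmannians $\mathrm{Gr}_p(\infty)$ and, for $V,W\in \mathrm{Gr}(\infty)$ with $\dim V=p$ and $\dim W=q$, let $$d(V,W)=\inf\nolimits_{[0,\Delta_p]}\{d_p(V,U): U\in \mathrm{Gr}_p(W)\}\in[0,\Delta_p],$$ where $\inf_{[0,\Delta_p]}$ denotes the infimum taken in the ordered set $([0,\Delta_p],\leq)$ (so that the infimum of the empty set is $\Delta_p$). Then $d$ is an asymmetric metric in $\mathrm{Gr}(\infty)$ and, for any $V,W\in \mathrm{Gr}(\infty)$ with $\dim V=p$ and $\dim W=q$, and any $W'\in\mathcal{P}_W(V)$, $$d(V,W)=d(V,W')=\begin{cases} d_p(V,W')=\Phi_p(\theta_1,\ldots,\theta_p) & \text{if } 0<p\leq q,\\ \Delta_p & \text{otherwise},\end{cases}$$ where $\theta_1\leq\cdots\leq\theta_p$ are the principal angles of $V$ and $W$.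
   Context: $\mathbb{F}=\mathbb{R}$ or $\mathbb{C}$, and $\mathbb{F}^n$ has its canonical inner product (Hermitian if $\mathbb{F}=\mathbb{C}$). $\mathrm{Gr}_p(n)$ is the set of $p$-dimensional subspaces of $\mathbb{F}^n$, and $\mathrm{Gr}_p(W)$ the set of $p$-dimensional subspaces of a subspace $W$ (empty if $p>\dim W$). With the natural inclusions $\mathrm{Gr}_p(n)\subset \mathrm{Gr}_p(n+1)$ (from $\mathbb{F}^n\subset\mathbb{F}^{n+1}$), $\mathrm{Gr}_p(\infty)=\bigcup_n \mathrm{Gr}_p(n)$ is the Infinite Grassmannian and $\mathrm{Gr}(\infty)=\bigcup_p \mathrm{Gr}_p(\infty)$ is the Infinite Total Grassmannian of all subspaces of all $\mathbb{F}^n$'s. Principal angles: for $\dim V=p$, $\dim W=q$ and $m=\min\{p,q\}\neq 0$, the principal angles $0\leq\theta_1\leq\cdots\leq\theta_m\leq\frac{\pi}{2}$ of $V$ and $W$ are $\theta_i=\cos^{-1}\sigma_i$, where $\sigma_1\geq\cdots\geq\sigma_m$ are the singular values of the orthogonal projection $V\to W$. Regular family: a family $\{d_p\}_{p\in\mathbb{N}}$ of metrics ($d_p$ a metric in $\mathrm{Gr}_p(\infty)$, with $\mathrm{Gr}_0(\infty)=\{0\}$) such that, for $0\neq p<q$: (i) $d_p(V,W)=\Phi_p(\theta_1,\ldots,\theta_p)$ for a nondecreasing (in each argument) function $\Phi_p$ of the principal angles $\theta_1\leq\cdots\leq\theta_p$ of $V,W\in \mathrm{Gr}_p(\infty)$;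 (ii) $\Phi_q(0,\ldots,0,\theta_1,\ldots,\theta_p)=\Phi_p(\theta_1,\ldots,\theta_p)$ (with $q-p$ zeros). $\Delta_p=\sup\{d_p(V,U):V,U\in \mathrm{Gr}_p(\infty)\}$ is the diameter of $\mathrm{Gr}_p(\infty)$ for $d_p$. $\mathcal{P}_W(V)$ is the set of projection subspaces of $W$ with respect to $V$: the subspaces $W'\subset W$ with $\dim W'=\min\{\dim V,\dim W\}$ and $P_W(V)\subset W'$, where $P_W$ is the orthogonal projection onto $W$. An asymmetric metric on a set $M$ is a function $d:M\times M\to[0,\infty]$ satisfying, for all $x,y,z\in M$: $d(x,y)=d(y,x)=0\Leftrightarrow x=y$; and $d(x,z)\leq d(x,y)+d(y,z)$. *)

(* Defs.v *)
From HB Require Import structures.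
From mathcomp Require Import all_boot all_order all_algebra.
From mathcomp Require Import sesquilinear.
From mathcomp Require Import complex.
From mathcomp Require Import all_classical all_reals all_analysis.

Set Implicit Arguments.
Unset Strict Implicit.
Unset Printing Implicit Defensive.

Import Order.TTheory GRing.Theory Num.Theory.

Local Open Scope classical_set_scope.
Local Open Scope ring_scope.

Inductive base_field := RealField | ComplexField.

Definition base_scalar (R : realType) (k : base_field) : numFieldType :=
  match k with RealField => R | ComplexField => R[i] end.

Definition conj_scalar (R : realType) (k : base_field) :
    involutive_rmorphism (base_scalar R k) :=
  match k with
  | RealField => idfun
  | ComplexField => @Num.conj R[i]
  end.

Definition of_real (R : realType) (k : base_field) : R -> base_scalar R k :=
  match k with
  | RealField => id
  | ComplexField => real_complex R
  end.
Arguments of_real {R} k _.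

Definition inner (R : realType) (k : base_field) (n : nat)
    (u v : 'rV[base_scalar R k]_n) : base_scalar R k :=
  \sum_i u 0 i * conj_scalar R k (v 0 i).

Lemma inner_is_bilinear (R : realType) (k : base_field) (n : nat) :
  bilinear_for
    (GRing.Scale.Law.clone _ _ *%R _)
    (GRing.Scale.Law.clone _ _ (conj_scalar R k \; *%R) _)
    (@inner R k n).
Proof.
split=> [v|u] a x y /=; rewrite /inner mulr_sumr -big_split /=;
  apply: eq_bigr => i _; rewrite !mxE.
  by rewrite mulrDl mulrA.
by rewrite rmorphD rmorphM mulrDr mulrCA.
Qed.

HB.instance Definition _ (R : realType) (k : base_field) (n : nat) :=
  bilinear_isBilinear.Build (base_scalar R k) _ _ _
    (GRing.Scale.Law.clone _ _ *%R _)
    (GRing.Scale.Law.clone _ _ (conj_scalar R k \; *%R) _)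
    (@inner R k n) (@inner_is_bilinear R k n).

Lemma inner_is_hermitian (R : realType) (k : base_field) (n : nat)
    (u v : 'rV[base_scalar R k]_n) :
  inner u v = (-1) ^+ false * conj_scalar R k (inner v u).
Proof.
rewrite expr0 mul1r /inner rmorph_sum; apply: eq_bigr => i _.
by rewrite rmorphM /= rmorphK mulrC.
Qed.

HB.instance Definition _ (R : realType) (k : base_field) (n : nat) :=
  isHermitianSesquilinear.Build _ _ _ _ (@inner R k n)
    (@inner_is_hermitian R k n).

Section PrincipalAngles.
Variables (R : realType) (k : base_field) (n : nat).
Local Notation F := (base_scalar R k).
Implicit Types (V W : {vspace 'rV[F]_n}).

Definition orthogonal_proj W : 'End('rV[F]_n) :=
  daddv_pi W (orthov (@inner R k n) W).

Definition orthonormal_basis V (e : seq 'rV[F]_n) : bool :=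
  basis_of V e && orthonormal (@inner R k n) e.

(* [s] lists the singular values of [T], seen as a linear map from [V] to [W],
   i.e. the diagonal of a singular value decomposition of [T].  The defaults of
   [s`_i] and [f`_i] make the last condition read [T e_i = 0] for the indices
   [i] with min(dim V, dim W) <= i < dim V. *)
Definition singular_values V W (T : 'End('rV[F]_n)) (s : seq R) : Prop :=
  [/\ size s = minn (\dim V) (\dim W),
      sorted >=%R s,
      all [pred x | 0 <= x] s &
      exists e f : seq 'rV[F]_n,
        [/\ orthonormal_basis V e, orthonormal_basis W f &
            forall i, (i < \dim V)%N -> T e`_i = of_real k s`_i *: f`_i]].

(* The list of singular values exists and is unique, so [xget] picks it. *)
Definition principal_angles V W : seq R :=
  map acos (xget [::] [set s | singular_values V W (orthogonal_proj W) s]).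

Definition projection_subspaces W V : set {vspace 'rV[F]_n} :=
  [set W' | [/\ (W' <= W)%VS, \dim W' = minn (\dim V) (\dim W) &
                (orthogonal_proj W @: V <= W')%VS]].

End PrincipalAngles.

(* F^n is identified with the set of sequences vanishing from rank n on, so
   that F^n is included in F^(n+1). *)
Definition sequence_of (R : realType) (k : base_field) (n : nat)
    (v : 'rV[base_scalar R k]_n) : nat -> base_scalar R k :=
  fun i => oapp (v 0) 0 (insub i).

Definition in_Gr (R : realType) (k : base_field) (n : nat)
    (V : {vspace 'rV[base_scalar R k]_n}) : set (nat -> base_scalar R k) :=
  [set sequence_of v | v in [set v | v \in V]].

Section Grassmannian.
Variables (R : realType) (k : base_field).
Local Notation F := (base_scalar R k).
Local Notation seqset := (set (nat -> F)).

Definition Gr_fin (p n : nat) : set seqset :=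
  [set in_Gr V | V in [set V : {vspace 'rV[F]_n} | \dim V = p]].

Definition Gr (p : nat) : set seqset := \bigcup_n Gr_fin p n.

Definition Gr_total : set seqset := \bigcup_p Gr p.

Definition Gr_sub (p : nat) (W : seqset) : set seqset :=
  Gr p `&` [set U | U `<=` W].

Definition Gr_dim (V : seqset) : nat := xget 0%N [set p | Gr p V].

End Grassmannian.
Arguments Gr_total : clear implicits.

Lemma in_Gr_widen (R : realType) (k : base_field) (n m : nat)
    (V : {vspace 'rV[base_scalar R k]_n}) : (n <= m)%N ->
  exists2 V' : {vspace 'rV[base_scalar R k]_m}, \dim V' = \dim V & in_Gr V' = in_Gr V.
Proof.
move=> le_nm; pose F := base_scalar R k.
pose f : 'Hom('rV[F]_n, 'rV[F]_m) := linfun (mulmxr (pid_mx n)).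
have fE v : f v = v *m pid_mx n by rewrite lfunE.
have f_seq v : sequence_of (f v) = sequence_of v.
  apply/funext => i; rewrite fE /sequence_of.
  case: insubP => [j _ ji|]; last first.
    rewrite -leqNgt => /(leq_trans le_nm) le_ni.
    by case: insubP => // i'; rewrite ltnNge le_ni.
  rewrite /= mxE; case: insubP => [i' _ i'i|].
    rewrite /= (bigD1 i') //= mxE ji i'i eqxx -i'i ltn_ord mulr1 big1 ?addr0 //.
    by move=> l ne_l; rewrite mxE ji -i'i val_eqE (negbTE ne_l) mulr0.
  rewrite -leqNgt => le_ni; apply: big1 => l _; rewrite mxE ji.
  by rewrite (ltn_eqF (leq_trans (ltn_ord l) le_ni)) mulr0.
have kerf : (V :&: lker f = 0)%VS.
  apply/eqP; rewrite -subv0; apply/subvP => v; rewrite memv_cap memv_ker fE.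
  case/andP=> _ /eqP v0; rewrite memv0; apply/eqP.
  have id_pid : (pid_mx n : 'M[F]_(n, m)) *m (pid_mx n : 'M[F]_(m, n)) = 1%:M.
    by rewrite mul_pid_mx minnn (minn_idPr le_nm) pid_mx_1.
  by rewrite -[v]mulmx1 -id_pid mulmxA v0 mul0mx.
exists (f @: V)%VS; first by rewrite limg_dim_eq.
apply/seteqP; split=> x /= [v vV <-].
  by case/memv_imgP: vV => u uV ->; exists u; rewrite // f_seq.
by exists (f v); rewrite ?f_seq //; apply: memv_img.
Qed.

(* Hence quantifying over pairs of subspaces of a common F^n, for all n, is
   quantifying over pairs of elements of the total Grassmannian. *)
Lemma Gr_common (R : realType) (k : base_field) (p q : nat)
    (V W : set (nat -> base_scalar R k)) : Gr p V -> Gr q W ->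
  exists n (V0 W0 : {vspace 'rV[base_scalar R k]_n}),
    [/\ \dim V0 = p, \dim W0 = q, V = in_Gr V0 & W = in_Gr W0].
Proof.
move=> [m _ [V0 /= dV <-]] [n _ [W0 /= dW <-]]; exists (maxn m n).
have [V1 dV1 V1E] := in_Gr_widen V0 (leq_maxl m n).
have [W1 dW1 W1E] := in_Gr_widen W0 (leq_maxr m n).
by exists V1, W1; rewrite dV1 dW1.
Qed.

Definition metric_on (R : realType) (T : Type) (M : set T) (d : T -> T -> R) :=
  [/\ forall x y, M x -> M y -> 0 <= d x y,
      forall x y, M x -> M y -> (d x y = 0 <-> x = y),
      forall x y, M x -> M y -> d x y = d y x &
      forall x y z, M x -> M y -> M z -> d x z <= d x y + d y z].

Definition asymmetric_metric_on (R : realType) (T : Type) (M : set T)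
    (d : T -> T -> \bar R) :=
  [/\ forall x y, M x -> M y -> (0 <= d x y)%E,
      forall x y, M x -> M y -> ((d x y = 0%E /\ d y x = 0%E) <-> x = y) &
      forall x y z, M x -> M y -> M z -> (d x z <= d x y + d y z)%E].

Definition angle_list (R : realType) (p : nat) (t : seq R) : Prop :=
  [/\ size t = p, sorted <=%R t & all [pred x | 0 <= x <= pi / 2] t].

Definition nondecreasing_in_each_argument (R : realType) (p : nat)
    (phi : seq R -> R) : Prop :=
  forall (t u : seq R) (i : nat), angle_list p t -> angle_list p u ->
    (forall j, j != i -> t`_j = u`_j) -> t`_i <= u`_i -> phi t <= phi u.

(* Only the restriction of [Phi p] to the lists [t] with [angle_list p t]
   matters; those are the possible lists of principal angles. *)
Definition regular_family (R : realType) (k : base_field)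
    (d : nat -> set (nat -> base_scalar R k) -> set (nat -> base_scalar R k) -> R)
    (Phi : nat -> seq R -> R) : Prop :=
  (forall p, metric_on (Gr p) (d p)) /\
  forall p q, (0 < p < q)%N ->
    [/\ nondecreasing_in_each_argument p (Phi p),
        forall n (V W : {vspace 'rV[base_scalar R k]_n}),
          \dim V = p -> \dim W = p ->
          d p (in_Gr V) (in_Gr W) = Phi p (principal_angles V W) &
        forall t, angle_list p t -> Phi q (nseq (q - p) 0 ++ t) = Phi p t].

Section Distance.
Variables (R : realType) (k : base_field).
Local Notation seqset := (set (nat -> base_scalar R k)).
Variable d : nat -> seqset -> seqset -> R.

Definition diameter (p : nat) : \bar R :=
  ereal_sup [set (d p VU.1 VU.2)%:E | VU in Gr p `*` Gr p].

(* Infimum of [S] in the ordered set [0, D]: its greatest lower bound there. *)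
Definition inf_in (D : \bar R) (S : set (\bar R)) : \bar R :=
  ereal_sup ([set x | (0 <= x <= D)%E] `&` lbound S).

Definition asym_dist (V W : seqset) : \bar R :=
  let p := Gr_dim V in
  inf_in (diameter p) [set (d p V U)%:E | U in Gr_sub p W].

End Distance.

(* Main.v *)
Require Import Defs.
From mathcomp Require Import all_boot all_order all_algebra.
From mathcomp Require Import sesquilinear complex spectral.
From mathcomp Require Import all_classical all_reals all_analysis.
From mathcomp Require Import zify.

(** The heart of the matter is a min-max comparison of singular values,
    [singular_values_le].  Let [V'] be a [p]-dimensional subspace of a
    [q]-dimensional [V], and suppose that |T v| <= |T' v| on [V'].  Then the [i]-th
    singular value of [T'] on [V'] is at least the [(q - p + i)]-th one of [T] on
    [V]: counting dimensions, [V'] contains a vector [v] of norm 1 for which |T' v|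
    is at most the former and |T v| at least the latter.  Taken for orthogonal
    projections, and read through the decreasing function [acos], it
    says all that is needed about principal angles ([principal_angles_le]).

    The infimum is attained at the projection subspaces.  If [W'] is one, the
    projections of vectors of [V] on [W] and on [W'] agree, so the angles of [V]
    with [W'] are those with [W]; any other [U] inside [W] gives shorter
    projections, hence larger angles, and [Phi p] is nondecreasing
    ([asym_dist_projection]).

    Padding with zeros links different dimensions: [Phi p t <= Phi q u] as soon as
    [t] is dominated by the [p] largest entries of [u] ([regular_le]).  Adding to
    two [p]-dimensional subspaces a common summand orthogonal to both then shows
    that the diameter is nondecreasing in the dimension ([diameter_mono]); and applied
    to [V'] inside [W], it bounds the distance from [V'] to its projection subspace
    in [Z] by the asymmetric distance from [W] to [Z] ([asym_dist_subspace]).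

    The triangle inequality follows.  When dim V <= dim W <= dim Z, go from [V] to
    a projection subspace [V'] of [W], from there to a projection subspace of [Z],
    and use the triangle inequality of [d p].  When the dimension drops at one of
    the two steps, that step costs a diameter which is at least that of the
    dimension of [V].  As to separation, a drop of dimension costs a positive
    diameter, so two subspaces at distance 0 in both directions have the same
    dimension [p], where [d p] separates them.

    Principal angles are chosen among the singular value decompositions of a
    projection, so such a decomposition has to exist over both scalar fields.  It
    comes from an orthonormal basis of [V] whose images by [T] are pairwise
    orthogonal, built from eigenvectors of Hermitian matrices
    ([exists_diagonalizing_basis], [exists_singular_values]). *)

Set Implicit Arguments.
Unset Strict Implicit.
Unset Printing Implicit Defensive.

Import Order.TTheory GRing.Theory Num.Theory.

Local Open Scope classical_set_scope.
Local Open Scope ring_scope.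

(** * Real and complex scalars *)

Section Scalars.
Variables (R : realType) (k : base_field).
Local Notation F := (base_scalar R k).

Lemma mul_conj_scalar (x : F) : x * conj_scalar R k x = `|x| ^+ 2.
Proof. by case: k x => x /=; [rewrite real_normK ?num_real // expr2 | rewrite normCK]. Qed.

Lemma of_realM (a b : R) : of_real k (a * b) = of_real k a * of_real k b.
Proof. by case: k => //=; rewrite rmorphM. Qed.

Lemma of_real0 : of_real k (0 : R) = 0.
Proof. by case: k => //=; rewrite rmorph0. Qed.

Lemma of_real_le (a b : R) : (of_real k a <= of_real k b) = (a <= b).
Proof. by case: k => //=; rewrite lecR. Qed.

Lemma of_real_inj : injective (@of_real R k).
Proof. by move=> a b /eqP; rewrite eq_le !of_real_le -eq_le => /eqP. Qed.

Lemma normr_of_real (a : R) : 0 <= a -> `|of_real k a| = of_real k a.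
Proof. by move=> a0; rewrite ger0_norm // -of_real0 of_real_le. Qed.

Lemma conj_of_real (a : R) : conj_scalar R k (of_real k a) = of_real k a.
Proof. by case: k => //=; exact: conjc_real. Qed.

Lemma nonneg_of_real (x : F) : 0 <= x -> exists2 a : R, 0 <= a & x = of_real k a.
Proof.
case: k x => x /= x0; first by exists x.
have xr : x \is Num.real by rewrite realE x0.
move: x0; rewrite -(RRe_real xr) => x0; exists (complex.Re x) => //.
  by rewrite -lecR.
Qed.

End Scalars.

(** * Orthonormal bases and orthogonal projections *)

Section InnerProduct.
Variables (R : realType) (k : base_field) (n : nat).
Local Notation F := (base_scalar R k).
Local Notation "''[' u , v ]" := (inner u v) : ring_scope.
Local Notation "''[' u ]" := (inner u u) : ring_scope.
Local Notation perp := (orthov (@inner R k n)).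
Implicit Types (u v w : 'rV[F]_n) (V W U : {vspace 'rV[F]_n}) (s e f : seq 'rV[F]_n).

Lemma innerDl u v w : '[u + v, w] = '[u, w] + '[v, w].
Proof. exact: linearDl. Qed.

Lemma innerDr u v w : '[u, v + w] = '[u, v] + '[u, w].
Proof. exact: linearDr. Qed.

Lemma innerBl u v w : '[u - v, w] = '[u, w] - '[v, w].
Proof. exact: linearBl. Qed.

Lemma innerZl a u v : '[a *: u, v] = a * '[u, v].
Proof. exact: linearZl_LR. Qed.

Lemma innerZr a u v : '[u, a *: v] = conj_scalar R k a * '[u, v].
Proof. by rewrite -[LHS]/(inner u (a *: v)) linearZr_LR. Qed.

Lemma inner0l v : '[0, v] = 0.
Proof. exact: linear0l. Qed.

Lemma inner_suml (I : finType) (P : pred I) (x : I -> 'rV[F]_n) w :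
  '[\sum_(i | P i) x i, w] = \sum_(i | P i) '[x i, w].
Proof. exact: linear_sumlz. Qed.

Lemma inner_sumr (I : finType) (P : pred I) (x : I -> 'rV[F]_n) w :
  '[w, \sum_(i | P i) x i] = \sum_(i | P i) '[w, x i].
Proof. exact: linear_sumr. Qed.

Lemma innerC u v : '[u, v] = conj_scalar R k '[v, u].
Proof. by rewrite [LHS]inner_is_hermitian expr0 mul1r. Qed.

Lemma inner_eq0C u v : '[u, v] = 0 -> '[v, u] = 0.
Proof. by move=> uv0; rewrite innerC uv0 rmorph0. Qed.

Lemma inner_norm v : '[v] = \sum_i `|v 0 i| ^+ 2.
Proof. by apply: eq_bigr => i _; rewrite mul_conj_scalar. Qed.

Lemma inner_ge0 v : 0 <= '[v].
Proof. by rewrite inner_norm; apply: sumr_ge0 => i _; rewrite exprn_ge0. Qed.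

Lemma inner_eq0 v : ('[v] == 0) = (v == 0).
Proof.
apply/eqP/eqP => [|->]; last exact: inner0l.
rewrite inner_norm => /eqP; rewrite psumr_eq0 => [/allP v0|i _]; last exact: exprn_ge0.
apply/rowP => i; have := v0 i (mem_index_enum i); rewrite mxE /=.
by rewrite sqrf_eq0 normr_eq0 => /eqP.
Qed.

Lemma inner_gt0 v : v != 0 -> 0 < '[v].
Proof. by move=> v0; rewrite lt0r inner_eq0 v0 inner_ge0. Qed.

Lemma pythagoras u v : '[u, v] = 0 -> '[u + v] = '[u] + '[v].
Proof.
by move=> uv; rewrite innerDl !innerDr uv (inner_eq0C uv) addr0 add0r.
Qed.

Lemma innerZ a v : '[a *: v] = `|a| ^+ 2 * '[v].
Proof. by rewrite innerZl innerZr mulrA mul_conj_scalar. Qed.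

Lemma sqr_normP v : exists2 a : R, 0 <= a & '[v] = of_real k (a ^+ 2).
Proof.
have [b b0 ->] := nonneg_of_real (inner_ge0 v).
by exists (Num.sqrt b); rewrite ?sqrtr_ge0 // sqr_sqrtr.
Qed.

Lemma normalize v : v != 0 -> exists2 a : F, a != 0 & '[a *: v] = 1.
Proof.
move=> v0; have [a a0 vE] := sqr_normP v.
have vn0 : of_real k a != 0.
  by apply: contra_neq v0 => a00; apply/eqP; rewrite -inner_eq0 vE expr2 of_realM a00 mul0r.
exists (of_real k a)^-1; first by rewrite invr_eq0.
rewrite innerZ normfV normr_of_real // vE expr2 of_realM.
by rewrite -expr2 -exprMn mulVf // expr1n.
Qed.

Lemma orthonormal_nthP s :
  reflect (forall i j, (i < size s)%N -> (j < size s)%N -> '[s`_i, s`_j] = (i == j)%:R)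
          (orthonormal (@inner R k n) s).
Proof.
rewrite /orthonormal; apply: (iffP andP) => [[/allP s1 so]|so].
  have lt_ij i j : (i < j)%N -> (j < size s)%N -> '[s`_i, s`_j] = 0.
    elim: s i j so {s1} => [|x s IHs] [|i] [|j] //=.
      case/andP; rewrite andbT => /allP xs _ _ js.
      exact/eqP/(xs _ (mem_nth _ js)).
    by case/andP => _ so; rewrite !ltnS; apply: IHs.
  move=> i j si sj; have [ij|ji|<-] := ltngtP i j; first exact: lt_ij.
    by apply/inner_eq0C/lt_ij.
  by apply/eqP/s1/mem_nth.
split; first by apply/(all_nthP 0) => i si /=; rewrite so // eqxx.
elim: s so => //= x s IHs so; rewrite IHs; last by move=> i j si sj; have := so i.+1 j.+1; apply.
rewrite !andbT; apply/(all_nthP 0) => i si; apply/eqP.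
by have := so 0%N i.+1; apply.
Qed.

Lemma inner_sum_orthonormal s (a : nat -> F) j : orthonormal (@inner R k n) s ->
  (j < size s)%N -> '[\sum_(i < size s) a i *: s`_i, s`_j] = a j.
Proof.
move=> /orthonormal_nthP so js; rewrite inner_suml (bigD1 (Ordinal js)) //=.
rewrite innerZl so // eqxx mulr1 big1 ?addr0 // => i ne_ij.
by rewrite innerZl so // -[j]/(val (Ordinal js)) val_eqE (negbTE ne_ij) mulr0.
Qed.

Lemma inner_orthonormal_free s : orthonormal (@inner R k n) s -> free s.
Proof.
move=> so; rewrite -(in_tupleE s); apply/freeP => a aS0 i.
pose b j := oapp a 0 (insub j).
have bE j : b (val j) = a j by rewrite /b valK.
rewrite -bE -(inner_sum_orthonormal b so (ltn_ord i)).
by under eq_bigr do rewrite bE; rewrite aS0 inner0l.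
Qed.

Lemma orthonormal_basisP V s : {subset s <= V} -> orthonormal (@inner R k n) s ->
  (\dim V <= size s)%N -> orthonormal_basis V s.
Proof.
move=> sV so les; rewrite /orthonormal_basis so andbT basisEfree.
by rewrite inner_orthonormal_free // les andbT; apply/span_subvP.
Qed.

Lemma orthonormal_basis_size V e : orthonormal_basis V e -> size e = \dim V.
Proof. by case/andP => /andP[/eqP <- /eqP]. Qed.

Lemma orthonormal_basis_sum V e v : orthonormal_basis V e -> v \in V ->
  v = \sum_(i < size e) '[v, e`_i] *: e`_i.
Proof.
move=> /andP[eV eo]; rewrite -(span_basis eV) => vV.
have := coord_span (X := in_tuple e) vV.
set a := fun j => oapp (fun i => coord (in_tuple e) i v) 0 (insub j).
have -> : \sum_(i < size e) coord (in_tuple e) i v *: (in_tuple e)`_i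
   = \sum_(i < size e) a i *: e`_i.
  by apply: eq_bigr => i _; rewrite /a valK.
move=> vE; rewrite {1}vE; apply: eq_bigr => i _; congr (_ *: _).
by rewrite [in RHS]vE inner_sum_orthonormal.
Qed.

Lemma inner_sum_norm s (a : nat -> F) : orthonormal (@inner R k n) s ->
  '[\sum_(i < size s) a i *: s`_i] = \sum_(i < size s) `|a i| ^+ 2.
Proof.
move=> so; rewrite [LHS]inner_sumr; apply: eq_bigr => i _.
by rewrite innerZr inner_sum_orthonormal // mulrC mul_conj_scalar.
Qed.

(** Each orthogonality condition lowers the dimension by at most one. *)
Lemma exists_orthogonal_vector V s : (size s < \dim V)%N ->
  exists2 v, v \in V & v != 0 /\ {in s, forall u, '[v, u] = 0}.
Proof.
elim: s V => [|u s IHs] V /=.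
  rewrite lt0n dimv_eq0 => V0; exists (vpick V); rewrite ?memv_pick //.
  by rewrite vpick0 V0.
move=> sV; have [|v] := IHs (V :&: perp <[u]>)%VS.
  apply: leq_trans (leq_dim_orthov1 (@inner R k n) u V).
  by rewrite ltn_predRL.
rewrite memv_cap mem_orthov1 => /andP[vV /eqP vu] [v0 vs].
exists v; rewrite // v0; split=> // w; rewrite inE => /predU1P[->|/vs] //.
Qed.

(** As long as the list is shorter than [\dim W], the space [W] contains a unit
    vector orthogonal to it, which can be appended. *)
Lemma extend_orthonormal W s : {subset s <= W} -> orthonormal (@inner R k n) s ->
  exists t, orthonormal_basis W (s ++ t).
Proof.
have [m] := ubnP (\dim W - size s); elim: m s => // m IHm s les sW so.
have [leWs|ltsW] := leqP (\dim W) (size s).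
  by exists [::]; rewrite cats0; apply: orthonormal_basisP.
have [v vW [v0 vs]] := exists_orthogonal_vector ltsW.
have [a a0 av1] := normalize v0.
have [| | |t tW] := IHm (rcons s (a *: v)).
- by rewrite size_rcons subnS -ltnS prednK ?subn_gt0.
- by move=> u; rewrite mem_rcons inE => /predU1P[->|/sW]//; rewrite memvZ.
- apply/orthonormal_nthP => i j; rewrite size_rcons !ltnS !nth_rcons.
  have avs l : (l < size s)%N -> '[a *: v, s`_l] = 0.
    by move=> ls; rewrite innerZl vs ?mulr0 // mem_nth.
  case: (ltngtP i (size s)) => // [si|->] _; case: (ltngtP j (size s)) => //.
  + by move=> sj _; apply: (orthonormal_nthP _ so).
  + by move=> -> _; rewrite (ltn_eqF si); apply/inner_eq0C/avs.
  + by move=> sj _; rewrite avs.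
by exists (a *: v :: t); rewrite -cat_rcons.
Qed.

Lemma exists_orthonormal_basis V : exists e, orthonormal_basis V e.
Proof. by have [|e] := @extend_orthonormal V [::] _ isT => //; exists e. Qed.

Lemma perp_cap0 W : (W :&: perp W = 0)%VS.
Proof.
apply/eqP; rewrite -subv0; apply/subvP => v; rewrite memv_cap memv0 -inner_eq0.
by case/andP => vW /mem_orthovP vp; rewrite vp.
Qed.

(** Removing from [v] its components along an orthonormal basis of [W] leaves a
    vector orthogonal to [W]. *)
Lemma perp_add W v : (v \in W + perp W)%VS.
Proof.
have [e eW] := exists_orthonormal_basis W; have [eB eo] := andP eW.
set w := \sum_(i < size e) '[v, e`_i] *: e`_i.
have wW : w \in W by apply: memv_suml => i _; rewrite memvZ // (basis_mem eB) // mem_nth.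
rewrite -[v](subrK w) addrC memv_add //; apply/mem_orthovP => u uW.
rewrite (orthonormal_basis_sum eW uW) [LHS]inner_sumr big1 // => i _.
by rewrite innerZr innerBl (inner_sum_orthonormal (fun j => '[v, e`_j])) // subrr mulr0.
Qed.

Lemma memv_orthogonal_proj W v : orthogonal_proj W v \in W.
Proof. exact: memv_pi. Qed.

Lemma orthogonal_projP W v w : w \in W -> '[v - orthogonal_proj W v, w] = 0.
Proof.
rewrite -{1}[v](daddv_pi_add (perp_cap0 W) (perp_add W v)) addrC addrA addNr add0r => wW.
exact: (mem_orthovP (memv_pi _ _ _)).
Qed.

(** If [x] is the projection, [x - w] lies in [W] and is the difference of the two
    vectors [v - w] and [v - x] orthogonal to [W]; so it is orthogonal to itself. *)
Lemma orthogonal_proj_unique W v w : w \in W -> {in W, forall u, '[v - w, u] = 0} ->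
  orthogonal_proj W v = w.
Proof.
move=> wW wo; set x := orthogonal_proj W v.
have xW : x \in W := memv_orthogonal_proj W v.
apply/eqP; rewrite -subr_eq0 -inner_eq0.
have -> : '[x - w] = '[(v - w) - (v - x), x - w].
  by congr (inner _ _); rewrite opprB [RHS]addrC addrA subrK.
by rewrite innerBl wo ?memvB // orthogonal_projP ?memvB // subrr.
Qed.

Lemma orthogonal_proj_sub U W v : (U <= W)%VS ->
  orthogonal_proj U (orthogonal_proj W v) = orthogonal_proj U v.
Proof.
move=> /subvP UW; apply: orthogonal_proj_unique; first exact: memv_orthogonal_proj.
move=> u uU; set x := orthogonal_proj W v.
have -> : x - orthogonal_proj U v = (v - orthogonal_proj U v) - (v - x).
  by rewrite opprB [RHS]addrC addrA subrK.
by rewrite innerBl !orthogonal_projP ?subrr // UW.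
Qed.

Lemma orthogonal_proj_le W v : '[orthogonal_proj W v] <= '[v].
Proof.
set x := orthogonal_proj W v.
have -> : '[v] = '[x] + '[v - x].
  have vx0 : '[v - x, x] = 0 by apply/orthogonal_projP/memv_orthogonal_proj.
  by rewrite -pythagoras ?(inner_eq0C vx0) // [x + _]addrC subrK.
by rewrite lerDl inner_ge0.
Qed.

Lemma orthogonal_proj_mono U W v : (U <= W)%VS ->
  '[orthogonal_proj U v] <= '[orthogonal_proj W v].
Proof. by move=> UW; rewrite -(orthogonal_proj_sub v UW) orthogonal_proj_le. Qed.

End InnerProduct.

(** * Singular values *)

Section Hermitian.
Variables (R : realType).

Lemma hermitian_adjoint (k : base_field) m (A : 'M[base_scalar R k]_m) u w :
  (forall i j, A i j = conj_scalar R k (A j i)) ->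
  inner (u *m A) w = inner u (w *m A).
Proof.
move=> Ah; rewrite /inner.
under eq_bigr do rewrite mxE mulr_suml.
under [RHS]eq_bigr do rewrite mxE rmorph_sum mulr_sumr.
rewrite exchange_big; apply: eq_bigr => i _; apply: eq_bigr => j _ /=.
by rewrite Ah rmorphM mulrAC mulrA.
Qed.

(** The eigenvalue is real: moving [A] across the inner product of an eigenvector
    with itself replaces the eigenvalue by its conjugate. *)
Lemma hermitian_complex_eigenvalue m (A : 'M[R[i]]_m.+1) :
  (forall i j, A i j = Num.conj (A j i)) -> exists a : R, eigenvalue A (real_complex R a).
Proof.
move=> Ah; have [a Aa] := eigenvalue_closed A (ltn0Sn m).
have /eigenvalueP[v vA v0] := Aa.
have := @hermitian_adjoint ComplexField _ A v v Ah.
rewrite vA innerZl innerZr => /eqP; rewrite -subr_eq0 -mulrBl mulf_eq0.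
rewrite (inner_eq0 (k := ComplexField)) (negbTE v0) orbF subr_eq0 eq_sym => /eqP a_real.
have : a \is Num.real by apply/CrealP.
by move=> /complex_realP[b ab]; exists b; rewrite -ab.
Qed.

(** A real symmetric matrix is Hermitian over the complex numbers, where it has an
    eigenvalue.  This eigenvalue is real, hence a root of the characteristic
    polynomial over the reals, and has a real eigenvector. *)
Lemma hermitian_eigenvector (k : base_field) m (A : 'M[base_scalar R k]_m.+1) :
  (forall i j, A i j = conj_scalar R k (A j i)) ->
  exists a, exists2 v : 'rV_m.+1, v *m A = a *: v & v != 0.
Proof.
case: k A => A Ah; last first.
  have [a /eigenvalueP[v vA v0]] := hermitian_complex_eigenvalue Ah.
  by exists (real_complex R a), v.
have [|a] := @hermitian_complex_eigenvalue m (map_mx (real_complex R) A).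
  move=> i j; rewrite !mxE Ah /=.
  exact/esym/(conj_of_real ComplexField).
rewrite eigenvalue_root_char -map_char_poly fmorph_root -eigenvalue_root_char.
by move=> /eigenvalueP[v vA v0]; exists a, v.
Qed.

End Hermitian.

Section SingularValues.
Variables (R : realType) (k : base_field) (n : nat).
Local Notation F := (base_scalar R k).
Local Notation "''[' u , v ]" := (inner u v) : ring_scope.
Local Notation "''[' u ]" := (inner u u) : ring_scope.
Local Notation perp := (orthov (@inner R k n)).
Implicit Types (u v w : 'rV[F]_n) (V W U : {vspace 'rV[F]_n}) (s e f : seq 'rV[F]_n).
Implicit Type T : 'End('rV[F]_n).

Lemma orthonormal_uniqP s :
  orthonormal (@inner R k n) s <->
  uniq s /\ {in s &, forall u w, '[u, w] = (u == w)%:R}.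
Proof.
split=> [so|[us so]].
  have us := free_uniq (inner_orthonormal_free so); split=> // u w us' ws.
  rewrite -{1}(nth_index 0 us') -{1}(nth_index 0 ws).
  rewrite (orthonormal_nthP _ so) ?index_mem //.
  by rewrite -(nth_uniq 0 _ _ us) ?index_mem // !nth_index.
by apply/orthonormal_nthP => i j si sj; rewrite so ?mem_nth // nth_uniq.
Qed.

(** This is a critical point of |T v|^2 on the unit sphere of [V].  It is found
    algebraically, as an eigenvector of the matrix of the form <T u, T w> in an
    orthonormal basis of [V]. *)
Lemma exists_stationary_vector V T : (0 < \dim V)%N ->
  exists2 v, v \in V & '[v] = 1 /\ exists a, {in V, forall w, '[T v, T w] = a * '[v, w]}.
Proof.
have [e eV] := exists_orthonormal_basis V; have [eB eo] := andP eV.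
have := orthonormal_basis_size eV; case: (\dim V) => // m es _.
pose A := \matrix_(i < m.+1, j < m.+1) '[T e`_i, T e`_j].
have [i j|a [x xA x0]] := @hermitian_eigenvector R k m A.
  by rewrite !mxE innerC.
have [v vE] : exists v, v = \sum_(i < m.+1) x 0 i *: e`_i by eexists.
have ve (j : 'I_m.+1) : '[v, e`_j] = x 0 j.
  pose b i := oapp (x 0) 0 (insub i).
  have -> : v = \sum_(i < size e) b i *: e`_i.
    by rewrite vE es; apply: eq_bigr => i _; rewrite /b valK.
  by rewrite inner_sum_orthonormal ?es // /b valK.
have vV : v \in V.
  by rewrite vE; apply: memv_suml => i _; rewrite memvZ // (basis_mem eB) // mem_nth // es.
have v0 : v != 0.
  apply: contra_neq x0 => v0; apply/rowP => j.
  by rewrite -ve v0 inner0l mxE.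
have Tv w : w \in V -> '[T v, T w] = a * '[v, w].
  move=> /(orthonormal_basis_sum eV) ->; rewrite es linear_sum [LHS]inner_sumr.
  rewrite [in RHS]inner_sumr mulr_sumr; apply: eq_bigr => j _.
  rewrite linearZ !innerZr ve mulrCA; congr (_ * _).
  have := congr1 (fun B : 'rV_m.+1 => B 0 j) xA; rewrite !mxE => <-.
  rewrite vE linear_sum inner_suml; apply: eq_bigr => i _.
  by rewrite linearZ innerZl mxE.
have [b b0 bv1] := normalize v0.
exists (b *: v); rewrite ?memvZ //; split=> //; exists a => w wV.
by rewrite linearZ !innerZl Tv // mulrCA.
Qed.

(** If [v] is a stationary vector, [T v] is orthogonal to the image of the
    orthogonal complement of [v] in [V], which has one dimension less. *)
Lemma exists_diagonalizing_basis V T : exists2 e, orthonormal_basis V e &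
  {in e &, forall u w, u != w -> '[T u, T w] = 0}.
Proof.
have [m] := ubnP (\dim V); elim: m V => // m IHm V Vm.
have [V0|V_gt0] := posnP (\dim V).
  have [e eV] := exists_orthonormal_basis V; exists e => // u.
  by have := orthonormal_basis_size eV; rewrite V0 => /size0nil ->.
have [v vV [v1 [a Tv]]] := exists_stationary_vector T V_gt0.
have dimV1 : (\dim (V :&: perp <[v]>)).+1 = \dim V.
  rewrite -eq_dim_orthov1 ?prednK //; apply/mem_orthovPn; exists v => //.
  by have /negbT : ('[v] == 0) = false by rewrite v1 oner_eq0.
have [|e eV1 Te] := IHm (V :&: perp <[v]>)%VS; first by rewrite dimV1.
have [eB /orthonormal_uniqP[ue eo]] := andP eV1.
have eV w : w \in e -> w \in V /\ '[v, w] = 0.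
  by move=> /(basis_mem eB); rewrite memv_cap mem_orthov1 => /andP[-> /eqP/inner_eq0C].
exists (v :: e).
  apply: orthonormal_basisP.
  - by move=> w; rewrite inE => /predU1P[->|/eV[]].
  - apply/orthonormal_uniqP; split=> /=.
      by rewrite ue andbT; apply/negP => /eV[_ /eqP]; rewrite v1 oner_eq0.
    have vN w : w \in e -> (v == w) = false.
      by move=> /eV[_ vw]; apply/eqP => E; move/eqP: vw; rewrite -E v1 oner_eq0.
    move=> u w; rewrite !inE => /predU1P[->|ue'] /predU1P[->|we] //.
    + by rewrite eqxx.
    + by rewrite vN //; case: (eV w we).
    + by rewrite eq_sym vN //; case: (eV u ue') => _ /inner_eq0C.
    + exact: eo.
  - by rewrite /= (orthonormal_basis_size eV1) dimV1.
have Tvw w : w \in e -> '[T v, T w] = 0.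
  by move=> /eV[wV vw]; rewrite Tv // vw mulr0.
move=> u w; rewrite !inE => /predU1P[->|ue'] /predU1P[->|we] //.
- by rewrite eqxx.
- by rewrite Tvw.
- by move=> _; apply/inner_eq0C/Tvw.
- exact: Te.
Qed.

Definition hnorm v : R := s2val (cid2 (sqr_normP v)).

Lemma hnorm_ge0 v : 0 <= hnorm v.
Proof. by rewrite /hnorm; case: cid2. Qed.

Lemma hnormE v : '[v] = of_real k (hnorm v ^+ 2).
Proof. by rewrite /hnorm; case: cid2. Qed.

Lemma hnorm_eq0 v : hnorm v = 0 -> v = 0.
Proof.
by move=> v0; apply/eqP; rewrite -inner_eq0 hnormE v0 expr2 mulr0 of_real0.
Qed.

(** The singular values are the norms of the images of a diagonalizing basis, in
    decreasing order; the nonzero images, normalized, are orthonormal in [W] and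
    can be completed to a basis. *)
Lemma exists_singular_values V W T : (\dim V <= \dim W)%N ->
  {in V, forall v, T v \in W} -> exists s : seq R, singular_values V W T s.
Proof.
move=> leVW TW; have [e0 e0V Te0] := exists_diagonalizing_basis V T.
pose le_T u v := hnorm (T v) <= hnorm (T u).
pose e := sort le_T e0; have pe : perm_eq e e0 by rewrite perm_sort.
have ee0 := perm_mem pe.
have [e0B /orthonormal_uniqP[ue0 e0o]] := andP e0V.
have ue : uniq e by rewrite (perm_uniq pe).
have eo : orthonormal (@inner R k n) e.
  apply/orthonormal_uniqP; split=> // u w; rewrite !ee0; exact: e0o.
have se : size e = \dim V by rewrite (perm_size pe) (orthonormal_basis_size e0V).
have eV : orthonormal_basis V e.
  by apply: orthonormal_basisP => //; rewrite ?se // => u; rewrite ee0 => /(basis_mem e0B).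
pose s := [seq hnorm (T v) | v <- e].
have ss : size s = \dim V by rewrite size_map.
have sE i : (i < \dim V)%N -> s`_i = hnorm (T e`_i).
  by move=> iV; rewrite (nth_map 0) ?se.
have s_sorted : sorted >=%R s.
  rewrite sorted_map; apply: (@sort_sorted _ le_T) => u v; exact: le_total.
have s_ge0 : all [pred x | 0 <= x] s.
  by apply/allP => _ /mapP[v _ ->]; apply: hnorm_ge0.
(* [s] is nonincreasing and nonnegative, so it vanishes from its first zero on. *)
pose r := find (pred1 0) s.
have rV : (r <= \dim V)%N by rewrite -ss find_size.
have s_neq0 i : (i < r)%N -> of_real k s`_i != 0.
  move=> ir; rewrite -of_real0 (inj_eq (@of_real_inj R k)).
  exact/negbT/(before_find 0 ir).
have s_eq0 i : (r <= i)%N -> (i < \dim V)%N -> s`_i = 0.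
  move=> ri iV; have si0 : 0 <= s`_i by apply: (allP s_ge0); rewrite mem_nth ?ss.
  have rs : (r < size s)%N by rewrite ss (leq_ltn_trans ri).
  have /eqP sr0 : s`_r == 0 by apply: (@nth_find _ 0 (pred1 0)); rewrite has_find.
  apply/eqP; rewrite eq_le si0 andbT -[leRHS]sr0.
  apply: (sorted_leq_nth (leT := >=%R)) => //; last by rewrite inE ss.
    by move=> x y z /= xy zx; apply: le_trans zx xy.
  exact: lexx.
have ltrV i : (i < r)%N -> (i < \dim V)%N by move=> ir; apply: leq_trans rV.
have eiV i : (i < \dim V)%N -> e`_i \in V.
  by move=> iV; case/andP: eV => eB _; rewrite (basis_mem eB) // mem_nth ?se.
pose f0 := mkseq (fun i => (of_real k s`_i)^-1 *: T e`_i) r.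
have f0W : {subset f0 <= W}.
  move=> _ /mapP[i + ->]; rewrite mem_iota => /= ir.
  by rewrite memvZ // TW // eiV // ltrV.
have f0o : orthonormal (@inner R k n) f0.
  apply/orthonormal_nthP => i j; rewrite size_mkseq => ir jr.
  rewrite !nth_mkseq //; have [<-|ne_ij] := eqVneq i j.
    rewrite innerZ normfV normr_of_real ?sE ?hnorm_ge0 ?ltrV // hnormE expr2 of_realM.
    by rewrite -expr2 -exprMn mulVf ?expr1n // -sE ?s_neq0 ?ltrV.
  rewrite innerZl innerZr Te0 ?mulr0 // -?ee0 ?mem_nth ?se ?ltrV //.
  by rewrite nth_uniq ?se ?ltrV.
have [t ft] := extend_orthonormal f0W f0o.
exists s; split=> //; first by rewrite ss (minn_idPl leVW).
exists e, (f0 ++ t); split=> // i iV.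
have [ir|ri] := ltnP i r.
  rewrite nth_cat size_mkseq ir nth_mkseq // scalerA mulfV ?scale1r ?s_neq0 //.
have si0 := s_eq0 i ri iV.
by rewrite si0 of_real0 scale0r; apply: hnorm_eq0; rewrite -sE.
Qed.

(** The images of the [e`_i] are orthogonal with norms [s`_i]: this is all that the
    comparison of singular values uses of a decomposition. *)
Lemma singular_values_norm V W T (s : seq R) : (\dim V <= \dim W)%N ->
  singular_values V W T s -> exists2 e, orthonormal_basis V e &
  {in V, forall v, '[T v] = \sum_(i < \dim V) `|'[v, e`_i]| ^+ 2 * of_real k (s`_i ^+ 2)}.
Proof.
move=> leVW [ss s_sorted s_ge0 [e [f [eV fW Te]]]]; exists e => // v vV.
have [_ fo] := andP fW.
pose g := take (\dim V) f.
have sg : size g = \dim V by rewrite size_takel // (orthonormal_basis_size fW).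
have go : orthonormal (@inner R k n) g.
  apply/orthonormal_nthP => i j; rewrite sg => iV jV; rewrite !nth_take //.
  by apply: (orthonormal_nthP _ fo); rewrite (orthonormal_basis_size fW) (leq_trans _ leVW).
have -> : T v = \sum_(i < size g) ('[v, e`_i] * of_real k s`_i) *: g`_i.
  rewrite {1}(orthonormal_basis_sum eV vV) (orthonormal_basis_size eV) sg linear_sum.
  by apply: eq_bigr => i _; rewrite linearZ /= Te // scalerA nth_take.
rewrite (inner_sum_norm (fun i => '[v, e`_i] * of_real k s`_i)) // sg.
apply: eq_bigr => i _; rewrite normrM exprMn normr_of_real ?(expr2 s`_i) ?of_realM //.
by apply: (allP s_ge0); rewrite mem_nth // ss (minn_idPl leVW).
Qed.

Lemma orthonormal_basis_norm V e v : orthonormal_basis V e -> v \in V ->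
  '[v] = \sum_(i < \dim V) `|'[v, e`_i]| ^+ 2.
Proof.
move=> eV vV; have [_ eo] := andP eV.
rewrite {1 2}(orthonormal_basis_sum eV vV) (inner_sum_norm (fun i => '[v, e`_i])) //.
by rewrite (orthonormal_basis_size eV).
Qed.

Lemma singular_values_nonincreasing V W T (s : seq R) i j : singular_values V W T s ->
  (i <= j)%N -> s`_j <= s`_i.
Proof.
move=> [ss s_sorted s_ge0 _] ij; have [js|sj] := ltnP j (size s); last first.
  rewrite [s`_j]nth_default //; have [si|si] := ltnP i (size s).
    by apply: (allP s_ge0); rewrite mem_nth.
  by rewrite nth_default.
apply: (sorted_leq_nth (leT := >=%R)) => //; last by rewrite inE (leq_ltn_trans ij).
  by move=> x y z /= xy zx; apply: le_trans zx xy.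
exact: lexx.
Qed.

Lemma singular_values_ge0 V W T (s : seq R) i : singular_values V W T s -> 0 <= s`_i.
Proof.
move=> [_ _ s_ge0 _]; have [js|sj] := ltnP i (size s); last by rewrite nth_default.
by apply: (allP s_ge0); rewrite mem_nth.
Qed.

Lemma of_real_sqr_mono (a b : R) : 0 <= a -> 0 <= b -> a <= b ->
  of_real k (a ^+ 2) <= of_real k (b ^+ 2).
Proof. by move=> a0 b0 ab; rewrite of_real_le lerXn2r. Qed.

(** With [m] the index on the left, look for a nonzero [v] in [V'] orthogonal to the
    basis vectors of [V] of index above [m] and to the basis vectors of [V'] of
    index below [i].  These are [\dim V' - 1] conditions, so [v] exists, and it
    satisfies s_m |v| <= |T v| <= |T' v| <= s'_i |v|. *)
Theorem singular_values_le V V' W W' T T' (s s' : seq R) i :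
  (\dim V <= \dim W)%N -> (\dim V' <= \dim W')%N ->
  singular_values V W T s -> singular_values V' W' T' s' ->
  (V' <= V)%VS -> {in V', forall v, '[T v] <= '[T' v]} ->
  (i < \dim V')%N -> s`_(\dim V - \dim V' + i) <= s'`_i.
Proof.
move=> leVW leVW' sv sv' V'V leT iV'.
have [e eV Tn] := singular_values_norm leVW sv.
have [e' eV' Tn'] := singular_values_norm leVW' sv'.
have dimV'V := dimvS V'V.
set m := (\dim V - \dim V' + i)%N.
have ltmV : (m < \dim V)%N by rewrite /m -ltn_subRL subKn.
have se := orthonormal_basis_size eV; have se' := orthonormal_basis_size eV'.
have [|v vV' [v0 ve]] := @exists_orthogonal_vector R k n V' (drop m.+1 e ++ take i e').
  rewrite size_cat size_drop size_takel ?se ?se'; last exact: ltnW.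
  by rewrite /m; lia.
have vV : v \in V by apply: (subvP V'V).
have vdrop (j : 'I_(\dim V)) : (m < j)%N -> '[v, e`_j] = 0.
  move=> mj; apply: ve; rewrite mem_cat; apply/orP; left.
  rewrite -(subnKC mj) -nth_drop mem_nth // size_drop se ltn_sub2r //.
  by rewrite (leq_ltn_trans mj).
have vtake (j : 'I_(\dim V')) : (j < i)%N -> '[v, e'`_j] = 0.
  move=> ji; apply: ve; rewrite mem_cat; apply/orP; right.
  by rewrite -(nth_take 0 ji) mem_nth // size_takel ?se' // ltnW.
have sm0 := singular_values_ge0 m sv; have s'i0 := singular_values_ge0 i sv'.
have le1 : '[v] * of_real k (s`_m ^+ 2) <= '[T v].
  rewrite (orthonormal_basis_norm eV vV) Tn // mulr_suml; apply: ler_sum => j _.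
  have [mj|jm] := ltnP m j; first by rewrite vdrop // normr0 expr2 !mul0r.
  rewrite ler_wpM2l ?exprn_ge0 // of_real_sqr_mono ?(singular_values_ge0 _ sv) //.
  exact: singular_values_nonincreasing sv jm.
have le2 : '[T' v] <= '[v] * of_real k (s'`_i ^+ 2).
  rewrite (orthonormal_basis_norm eV' vV') Tn' // mulr_suml; apply: ler_sum => j _.
  have [ji|ij] := ltnP j i; first by rewrite vtake // normr0 expr2 !mul0r.
  rewrite ler_wpM2l ?exprn_ge0 // of_real_sqr_mono ?(singular_values_ge0 _ sv') //.
  exact: singular_values_nonincreasing sv' ij.
have := le_trans (le_trans le1 (leT v vV')) le2.
by rewrite ler_pM2l ?inner_gt0 // of_real_le ler_sqr ?nnegrE.
Qed.

Lemma singular_values_le1 V W T (s : seq R) i : (\dim V <= \dim W)%N ->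
  singular_values V W T s -> (forall v, '[T v] <= '[v]) -> s`_i <= 1.
Proof.
move=> leVW sv leT; have [iV|Vi] := ltnP i (\dim V); last first.
  by case: sv => ss _ _ _; rewrite nth_default ?ler01 // ss (minn_idPl leVW).
have [e eV Tn] := singular_values_norm leVW sv; have [eB eo] := andP eV.
have ei : e`_i \in e by rewrite mem_nth // (orthonormal_basis_size eV).
have eiV := basis_mem eB ei.
have ei1 j : (j < \dim V)%N -> '[e`_i, e`_j] = (i == j)%:R.
  by move=> jV; apply: (orthonormal_nthP _ eo); rewrite (orthonormal_basis_size eV).
have := leT e`_i; rewrite Tn // (bigD1 (Ordinal iV)) //= big1 => [|j ne_ji].
  rewrite addr0 !ei1 // eqxx normr1 expr1n mul1r => si1.
  have : of_real k (s`_i ^+ 2) <= of_real k 1 by case: (k) si1.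
  by rewrite of_real_le expr_le1 // (singular_values_ge0 _ sv).
move: ne_ji; rewrite -val_eqE /= eq_sym => /negbTE ne_ji.
by rewrite ei1 // ne_ji normr0 expr2 !mul0r.
Qed.

End SingularValues.

(** * Principal angles *)

Section Acos.
Variable R : realType.

Lemma acos_anti (x y : R) : 0 <= x -> y <= 1 -> x <= y -> acos y <= acos x.
Proof.
move=> x0 y1 xy.
have I (z : R) : 0 <= z -> z <= 1 -> -1 <= z <= 1.
  by move=> z0 ->; rewrite andbT (le_trans _ z0) // lerN10.
have xI := I x x0 (le_trans xy y1); have yI := I y (le_trans x0 xy) y1.
rewrite leNgt -ltr_cos ?in_itv /= ?acos_ge0 ?acos_lepi //.
by rewrite !acosK ?in_itv //= -leNgt.
Qed.

Lemma acos_bounds (x : R) : 0 <= x <= 1 -> 0 <= acos x <= pi / 2.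
Proof.
move=> /andP[x0 x1]; rewrite acos_ge0 ?x1 ?andbT ?(le_trans _ x0) ?lerN10 //=.
by rewrite -acos0 acos_anti.
Qed.

End Acos.

Section PrincipalAngles.
Variables (R : realType) (k : base_field) (n : nat).
Local Notation F := (base_scalar R k).
Local Notation "''[' u ]" := (inner u u) : ring_scope.
Implicit Types (V W U : {vspace 'rV[F]_n}).

(** Existence of a decomposition is what gives the chosen value of
    [principal_angles] its meaning. *)
Lemma principal_anglesP V W : (\dim V <= \dim W)%N -> exists2 s : seq R,
  singular_values V W (orthogonal_proj W) s & principal_angles V W = map acos s.
Proof.
move=> leVW; have [|s sv] := @exists_singular_values R k n V W (orthogonal_proj W) leVW.
  by move=> v _; apply: memv_orthogonal_proj.
rewrite /principal_angles; case: xgetP => [t _ tv|]; first by exists t.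
by move=> /(_ s).
Qed.

Lemma angle_list_principal_angles V W : (\dim V <= \dim W)%N ->
  angle_list (\dim V) (principal_angles V W).
Proof.
move=> leVW; have [s sv ->] := principal_anglesP leVW.
have s1 i : s`_i <= 1 := singular_values_le1 i leVW sv (orthogonal_proj_le W).
have s0 i : 0 <= s`_i := singular_values_ge0 i sv.
split.
- by case: sv => ss _ _ _; rewrite size_map ss (minn_idPl leVW).
- apply/(sortedP 0) => i; rewrite size_map => i1s.
  rewrite !(nth_map 0) // 1?ltnW // acos_anti //.
  exact: singular_values_nonincreasing sv _.
- apply/allP => _ /mapP[x xs ->] /=; apply: acos_bounds.
  by rewrite -(nth_index 0 xs) s0 s1.
Qed.

Lemma principal_angles_le V V' W W' i :
  (\dim V <= \dim W)%N -> (\dim V' <= \dim W')%N -> (V' <= V)%VS ->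
  {in V', forall v, '[orthogonal_proj W v] <= '[orthogonal_proj W' v]} ->
  (i < \dim V')%N ->
  (principal_angles V' W')`_i <= (principal_angles V W)`_(\dim V - \dim V' + i).
Proof.
move=> leVW leVW' V'V leT iV'.
have [s sv ->] := principal_anglesP leVW; have [s' sv' ->] := principal_anglesP leVW'.
have ss : size s = \dim V by case: sv => -> *; rewrite (minn_idPl leVW).
have ss' : size s' = \dim V' by case: sv' => -> *; rewrite (minn_idPl leVW').
have dVV' := dimvS V'V.
rewrite !(nth_map 0) ?ss ?ss' //; last by lia.
apply: acos_anti; first exact: singular_values_ge0 sv.
  exact: singular_values_le1 leVW' sv' (orthogonal_proj_le W').
exact: singular_values_le sv sv' V'V leT iV'.
Qed.

Lemma orthogonal_proj_projection_subspace V W W' v :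
  projection_subspaces W V W' -> v \in V -> orthogonal_proj W' v = orthogonal_proj W v.
Proof.
move=> [W'W _ /subvP PV] vV; rewrite -(orthogonal_proj_sub v W'W).
apply: orthogonal_proj_unique; first by apply/PV/memv_img.
by move=> u _; rewrite subrr inner0l.
Qed.

(** The two projections agree on [V], so each list of angles is below the other. *)
Lemma principal_angles_projection_subspace V W W' : (\dim V <= \dim W)%N ->
  projection_subspaces W V W' -> principal_angles V W' = principal_angles V W.
Proof.
move=> leVW W'P; have [W'W dW' _] := W'P; rewrite (minn_idPl leVW) in dW'.
have leVW' : (\dim V <= \dim W')%N by rewrite dW'.
have [s _ _] := angle_list_principal_angles leVW.
have [s' _ _] := angle_list_principal_angles leVW'.
apply: (@eq_from_nth _ 0) => [|i]; rewrite s' ?s // => iV; apply/eqP.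
have := @principal_angles_le V V W W' i leVW leVW' (subvv _).
have := @principal_angles_le V V W' W i leVW' leVW (subvv _).
rewrite subnn add0n eq_le => -> //.
  by move=> -> // v vV; rewrite (orthogonal_proj_projection_subspace W'P).
by move=> v vV; rewrite (orthogonal_proj_projection_subspace W'P).
Qed.

Lemma exists_intermediate_subspace U W m : (U <= W)%VS -> (\dim U <= m <= \dim W)%N ->
  exists2 W' : {vspace 'rV[F]_n}, \dim W' = m & (U <= W' <= W)%VS.
Proof.
move=> UW /andP[Um mW]; have [e eU] := exists_orthonormal_basis U.
have [eB eo] := andP eU; have es := orthonormal_basis_size eU.
have [|t etW] := extend_orthonormal (W := W) _ eo.
  by move=> u /(basis_mem eB); apply: (subvP UW).
have [etB _] := andP etW; have ets := orthonormal_basis_size etW.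
exists <<take m (e ++ t)>>%VS.
  have : free (take m (e ++ t)).
    by apply: (@catl_free _ _ (drop m (e ++ t))); rewrite cat_take_drop (basis_free etB).
  by rewrite /free => /eqP ->; rewrite size_takel // ets.
apply/andP; split.
  rewrite -(span_basis eB); apply: sub_span => u ue.
  by rewrite take_cat es ltnNge Um /= mem_cat ue.
by apply/span_subvP => u /mem_take /(basis_mem etB).
Qed.

Lemma exists_projection_subspace V W : exists W', projection_subspaces W V W'.
Proof.
have [||W' dW' /andP[PW' W'W]] :=
  @exists_intermediate_subspace (orthogonal_proj W @: V) W (minn (\dim V) (\dim W)).
- by apply/subvP => _ /memv_imgP[v _ ->]; apply: memv_orthogonal_proj.
- rewrite geq_minr leq_min andbT -[X in (_ <= X)%N](limg_ker_dim (orthogonal_proj W)).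
  rewrite leq_addl dimvS //.
  by apply/subvP => _ /memv_imgP[v _ ->]; apply: memv_orthogonal_proj.
by exists W'.
Qed.

Lemma projection_subspaces_self V W W' : (\dim V <= \dim W)%N ->
  projection_subspaces W V W' -> projection_subspaces W' V W'.
Proof.
move=> leVW [_ dW' _]; rewrite (minn_idPl leVW) in dW'.
split; rewrite ?subvv ?dW' ?minnn //.
by apply/subvP => _ /memv_imgP[v _ ->]; apply: memv_orthogonal_proj.
Qed.

End PrincipalAngles.

(** * Nondecreasing functions of the angles *)

Section Monotone.
Variable R : realType.
Implicit Types (t u : seq R) (phi : seq R -> R).

Lemma angle_list_ge0 p (t : seq R) i : angle_list p t -> 0 <= t`_i.
Proof.
move=> [st _ t_all]; have [ip|pi] := ltnP i p; last by rewrite nth_default ?st.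
by have := all_nthP 0 t_all i; rewrite st => /(_ ip) /andP[].
Qed.

Lemma angle_list_nseq p q (t : seq R) : (p <= q)%N -> angle_list p t ->
  angle_list q (nseq (q - p) 0 ++ t).
Proof.
move=> pq tp; have [st t_sorted t_all] := tp.
split; first by rewrite size_cat size_nseq st subnK.
  apply/(sortedP 0) => i; rewrite size_cat size_nseq st subnK // => iq.
  rewrite !nth_cat !size_nseq !nth_nseq.
  have [iqp|qpi] := ltnP i (q - p).
    by case: (i.+1 < q - p)%N => //; apply: angle_list_ge0 tp.
  rewrite ltnNge (leq_trans qpi) //= subSn //.
  by apply: (sortedP 0 t_sorted); rewrite st; lia.
rewrite all_cat t_all andbT; apply/allP => _ /nseqP[-> _] /=.
by rewrite lexx divr_ge0 ?pi_ge0.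
Qed.

(** The junction is in order because [t`_m.-1 <= t`_m <= u`_m]. *)
Lemma angle_list_hybrid p t u m : angle_list p t -> angle_list p u ->
  (forall i, t`_i <= u`_i) -> angle_list p (take m t ++ drop m u).
Proof.
move=> [st t_sorted t_all] [su u_sorted u_all] tu.
have nthE i : (take m t ++ drop m u)`_i = if (i < m)%N then t`_i else u`_i.
  rewrite nth_cat size_take_min st; have [im|mi] := ltnP i m.
    have [ip|pi] := ltnP i p; first by rewrite leq_min im ip nth_take.
    by rewrite ltn_min im ltnNge pi /= nth_drop !nth_default ?st ?su //; lia.
  rewrite ltn_min ltnNge mi /= nth_drop; have [ip|pi] := ltnP i p.
    by congr (u`_ _); lia.
  by rewrite !nth_default ?su //; lia.
have sp : size (take m t ++ drop m u) = p.
  by rewrite size_cat size_take_min size_drop st su; lia.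
split=> //.
  apply/(sortedP 0) => i; rewrite sp !nthE => ip.
  have ti : t`_i <= t`_i.+1 by apply: (sortedP 0 t_sorted); rewrite st.
  have ui : u`_i <= u`_i.+1 by apply: (sortedP 0 u_sorted); rewrite su.
  case: (ltnP i.+1 m) => im; first by rewrite (ltnW im).
  by case: ifP => // _; apply: le_trans (tu _) ui.
apply/(all_nthP 0) => i; rewrite sp nthE => ip.
by case: ifP => _; [apply: (all_nthP 0 t_all) | apply: (all_nthP 0 u_all)]; rewrite ?st ?su.
Qed.

(** Monotonicity is given only for a change of one entry between two sorted lists.
    Raising the entries of [t] to those of [u] from the last to the first keeps
    the lists sorted. *)
Lemma nondecreasing_pointwise p phi t u : nondecreasing_in_each_argument p phi ->
  angle_list p t -> angle_list p u -> (forall i, t`_i <= u`_i) -> phi t <= phi u.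
Proof.
move=> phi_nd tp up tu; have [st _ _] := tp; have [su _ _] := up.
pose h m := take m t ++ drop m u.
have hp : h p = t by rewrite /h -{1}st take_size -su drop_size cats0.
have h0 : h 0%N = u by rewrite /h take0 drop0.
rewrite -hp -h0; have : (p <= p)%N := leqnn p.
(* [h m.+1] and [h m] differ at index [m] only. *)
elim: {1 3}p => // m IHm mp; apply: le_trans (IHm (ltnW mp)).
apply: (phi_nd _ _ m); try exact: angle_list_hybrid.
  move=> j jm; rewrite /h !nth_cat !size_takel ?st //; last exact: ltnW.
  rewrite ltnS; case: ltngtP jm => // jm _.
    by rewrite !nth_take // ltnW.
  by rewrite !nth_drop; congr (u`_ _); lia.
rewrite /h !nth_cat !size_takel ?st //; last exact: ltnW.
by rewrite ltnS leqnn ltnn subnn nth_take // nth_drop addn0.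
Qed.

End Monotone.

(** * Subspaces as sets of sequences *)

Section Coordinates.
Variables (R : realType) (k : base_field).
Local Notation F := (base_scalar R k).

Lemma sequence_of_ord n (v : 'rV[F]_n) (i : 'I_n) : sequence_of v i = v 0 i.
Proof. by rewrite /sequence_of valK. Qed.

Lemma sequence_of_inj n : injective (@sequence_of R k n).
Proof.
by move=> u v uv; apply/rowP => i; rewrite -!sequence_of_ord uv.
Qed.

Lemma in_Gr_subset n (V W : {vspace 'rV[F]_n}) :
  in_Gr V `<=` in_Gr W <-> (V <= W)%VS.
Proof.
split=> [VW|/subvP VW].
  apply/subvP => v vV; have [|w wW /sequence_of_inj <- //] := VW (sequence_of v).
  by exists v.
by move=> _ [v vV <-]; exists v => //; apply: VW.
Qed.

Lemma in_Gr_inj n : injective (@in_Gr R k n).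
Proof.
move=> V W VW; apply/eqP; rewrite eqEsubv.
by apply/andP; split; apply/in_Gr_subset; rewrite VW.
Qed.

(** The vectors of [V] have zero coordinates from rank [n] on, so dropping these
    coordinates loses nothing. *)
Lemma in_Gr_narrow n m (V : {vspace 'rV[F]_m}) :
  in_Gr V `<=` range (@sequence_of R k n) ->
  exists2 V' : {vspace 'rV[F]_n}, \dim V' = \dim V & in_Gr V' = in_Gr V.
Proof.
move=> Vn; pose g : 'Hom('rV[F]_m, 'rV[F]_n) := linfun (mulmxr (pid_mx m)).
have gE v j : g v 0 j = sequence_of v j.
  rewrite lfunE /= mxE /sequence_of; case: insubP => [i _ ij|].
    rewrite /= (bigD1 i) //= mxE ij eqxx -ij ltn_ord mulr1 big1 ?addr0 // => l ne_li.
    by rewrite mxE -ij val_eqE (negbTE ne_li) mulr0.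
  rewrite -leqNgt => mj; apply: big1 => l _; rewrite mxE.
  by rewrite (ltn_eqF (leq_trans (ltn_ord l) mj)) mulr0.
have g_seq v : v \in V -> sequence_of (g v) = sequence_of v.
  move=> vV; have [|w _ wv] := Vn (sequence_of v); first by exists v.
  have -> : g v = w by apply/rowP => j; rewrite gE -wv sequence_of_ord.
  exact: wv.
exists (g @: V)%VS.
  apply: limg_dim_eq; apply/eqP; rewrite -subv0; apply/subvP => v.
  rewrite memv_cap memv_ker memv0 => /andP[vV /eqP gv0]; apply/eqP/sequence_of_inj.
  rewrite -g_seq // gv0; apply/funext => i; rewrite /sequence_of.
  by do 2! case: insubP => [? _ _|_] /=; rewrite ?mxE.
apply/seteqP; split=> x /= [v vV <-].
  by case/memv_imgP: vV => u uV ->; exists u; rewrite ?g_seq.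
by exists (g v); rewrite ?g_seq //; apply: memv_img.
Qed.

Lemma dim_in_Gr n m (V : {vspace 'rV[F]_n}) (W : {vspace 'rV[F]_m}) :
  in_Gr V = in_Gr W -> \dim V = \dim W.
Proof.
move=> VW; have [|W' <- W'E] := @in_Gr_narrow n m W.
  by rewrite -VW => _ [v _ <-]; exists v.
by congr (\dim _); apply: in_Gr_inj; rewrite W'E.
Qed.

Lemma Gr_in_Gr n p (V : {vspace 'rV[F]_n}) : Gr p (in_Gr V) <-> \dim V = p.
Proof.
split=> [[m _ [W /= <- WV]]|dV]; first exact/esym/dim_in_Gr.
by exists n => //; exists V.
Qed.

Lemma Gr_dim_in_Gr n (V : {vspace 'rV[F]_n}) : Gr_dim (in_Gr V) = \dim V.
Proof.
rewrite /Gr_dim; case: xgetP => [p _ /Gr_in_Gr //|/(_ (\dim V)) []].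
exact/Gr_in_Gr.
Qed.

Lemma Gr_sub_in_Gr n p (W : {vspace 'rV[F]_n}) U :
  Gr_sub p (in_Gr W) U <->
  exists U0 : {vspace 'rV[F]_n}, [/\ \dim U0 = p, (U0 <= W)%VS & U = in_Gr U0].
Proof.
split=> [[[m _ [U1 /= dU1 <-]] UW]|[U0 [dU0 U0W ->]]]; last first.
  by split; [exact/Gr_in_Gr | apply/in_Gr_subset].
have [|U0 dU0 U0E] := @in_Gr_narrow n m U1.
  by move=> x /UW [w _ <-]; exists w.
by exists U0; split; rewrite ?dU0 // ?U0E //; apply/in_Gr_subset; rewrite U0E.
Qed.

Lemma Gr_total_common V W Z : Gr_total R k V -> Gr_total R k W -> Gr_total R k Z ->
  exists n (V0 W0 Z0 : {vspace 'rV[F]_n}), [/\ V = in_Gr V0, W = in_Gr W0 & Z = in_Gr Z0].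
Proof.
move=> [p _ VG] [q _ WG] [r _ [m _ [Z0 _ <-]]].
have [n [V0 [W0 [_ _ -> ->]]]] := Gr_common VG WG.
have [V1 _ <-] := in_Gr_widen V0 (leq_maxl n m).
have [W1 _ <-] := in_Gr_widen W0 (leq_maxl n m).
have [Z1 _ <-] := in_Gr_widen Z0 (leq_maxr n m).
by exists (maxn n m), V1, W1, Z1.
Qed.

Lemma exists_Gr p : exists V : set (nat -> F), Gr p V.
Proof.
by exists (in_Gr (fullv : {vspace 'rV[F]_p})); apply/Gr_in_Gr; rewrite dimvf /dim /= mul1n.
Qed.

Lemma Gr0_unique (V W : set (nat -> F)) : Gr 0 V -> Gr 0 W -> V = W.
Proof.
move=> VG WG; have [n [V0 [W0 [/eqP + /eqP + -> ->]]]] := Gr_common VG WG.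
by rewrite !dimv_eq0 => /eqP -> /eqP ->.
Qed.

End Coordinates.

(** * The asymmetric distance of a regular family *)

Section Infimum.
Variable R : realType.
Implicit Types (D m : \bar R) (S : set (\bar R)).
Local Open Scope ereal_scope.

Lemma inf_in_min D S m : S m -> lbound S m -> 0 <= m <= D -> inf_in D S = m.
Proof.
move=> Sm mS m0D; apply/eqP; rewrite eq_le; apply/andP; split.
  by apply: ge_ereal_sup => x [_ /(_ m Sm)].
by apply: ereal_sup_ubound; split.
Qed.

Lemma inf_in_set0 D : 0 <= D -> inf_in D set0 = D.
Proof.
move=> D0; apply/eqP; rewrite eq_le; apply/andP; split.
  by apply: ge_ereal_sup => x [/andP[]].
by apply: ereal_sup_ubound; split=> //=; rewrite D0 lexx.
Qed.

Lemma inf_in_le D S : inf_in D S <= D.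
Proof. by apply: ge_ereal_sup => x [/andP[]]. Qed.

Lemma inf_in_ge0 D S : 0 <= D -> lbound S 0 -> 0 <= inf_in D S.
Proof. by move=> D0 S0; apply: ereal_sup_ubound; split=> //=; rewrite lexx. Qed.

End Infimum.

Section RegularFamily.
Variables (R : realType) (k : base_field).
Local Notation F := (base_scalar R k).
Variables (d : nat -> set (nat -> F) -> set (nat -> F) -> R) (Phi : nat -> seq R -> R).
Hypothesis dPhi : regular_family d Phi.

Local Lemma d_metric p : metric_on (Gr p) (d p).
Proof. exact: dPhi.1. Qed.

(** Regularity speaks of [d p] through a pair of dimensions [p < q]; take [q] to be
    [p + 1]. *)
Lemma regular_angles n p (V W : {vspace 'rV[F]_n}) : (0 < p)%N ->
  \dim V = p -> \dim W = p -> d p (in_Gr V) (in_Gr W) = Phi p (principal_angles V W).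
Proof.
move=> p0; have p_lt : (0 < p < p.+1)%N by rewrite p0 ltnSn.
by have [_ dE _] := dPhi.2 _ _ p_lt; apply: dE.
Qed.

Lemma regular_nondecreasing p : (0 < p)%N -> nondecreasing_in_each_argument p (Phi p).
Proof.
move=> p0; have p_lt : (0 < p < p.+1)%N by rewrite p0 ltnSn.
by have [] := dPhi.2 _ _ p_lt.
Qed.

(** Pad [t] with zeros to the length of [u]: this does not change the value, and
    the padded list is below [u] entry by entry. *)
Lemma regular_le p q t u : (0 < p <= q)%N -> angle_list p t -> angle_list q u ->
  (forall i, (i < p)%N -> t`_i <= u`_(q - p + i)) -> Phi p t <= Phi q u.
Proof.
move=> /andP[p0 pq] tp uq tu; have [st _ _] := tp; have [su _ _] := uq.
have Phi_nd := regular_nondecreasing (leq_trans p0 pq).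
have <- : Phi q (nseq (q - p) 0 ++ t) = Phi p t.
  have [<-|ne_pq] := eqVneq p q; first by rewrite subnn.
  have pltq : (0 < p < q)%N by rewrite p0 ltn_neqAle ne_pq.
  by have [_ _ ->] := dPhi.2 _ _ pltq.
apply: (nondecreasing_pointwise Phi_nd) => //; first exact: angle_list_nseq.
move=> i; rewrite nth_cat size_nseq nth_nseq.
have [iqp|qpi] := ltnP i (q - p); first exact: angle_list_ge0 uq.
have [iq|qi] := ltnP i q; last by rewrite !nth_default ?st ?su //; lia.
by have := tu (i - (q - p))%N; rewrite subnKC //; apply; lia.
Qed.

Lemma d_le_diameter p V W : Gr p V -> Gr p W -> ((d p V W)%:E <= diameter d p)%E.
Proof. by move=> VG WG; apply: ereal_sup_ubound; exists (V, W). Qed.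

Lemma diameter_ge0 p : (0 <= diameter d p)%E.
Proof.
have [V VG] := exists_Gr R k p; have [d0 _ _ _] := d_metric p.
by apply: le_trans (d_le_diameter VG VG); rewrite lee_fin d0.
Qed.

(** The hyperplanes of F^(p + 1) already include two different ones: F^p, which
    contains the first coordinate vector, and a complement of this vector. *)
Lemma diameter_gt0 p : (0 < p)%N -> (0 < diameter d p)%E.
Proof.
move=> p0; pose V : {vspace 'rV[F]_p} := fullv.
have dV : \dim V = p by rewrite dimvf /dim /= mul1n.
(* Both spaces live in different F^n: compare them on the first coordinate vector. *)
pose e0 : 'rV[F]_p.+1 := delta_mx 0 0; pose l := <[e0]>%VS.
have dl : \dim l = 1%N.
  rewrite dim_vline; apply/eqP; rewrite eqb1; apply/eqP => /rowP /(_ ord0).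
  by rewrite !mxE !eqxx => /eqP; rewrite oner_eq0.
pose W := (l^C)%VS.
have dW : \dim W = p by rewrite dimv_compl dl dimvf /dim /= mul1n subn1.
have VG : Gr p (in_Gr V) by apply/Gr_in_Gr.
have WG : Gr p (in_Gr W) by apply/Gr_in_Gr.
apply: lt_le_trans (d_le_diameter VG WG).
have [d0 deq _ _] := d_metric p.
rewrite lte_fin lt_def d0 // andbT; apply/eqP => /(deq _ _ VG WG) VW.
have : in_Gr V (sequence_of (delta_mx 0 (Ordinal p0) : 'rV[F]_p)).
  by exists (delta_mx 0 (Ordinal p0)) => //=; rewrite memvf.
rewrite VW => -[w wW ws].
have wE : w = e0.
  apply/rowP => i; rewrite -sequence_of_ord ws mxE eqxx /sequence_of /=.
  case: insubP => [j _ ji|] /=; first by rewrite mxE eqxx -!val_eqE /= ji.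
  by rewrite -leqNgt -val_eqE /= => pi; rewrite (gtn_eqF (leq_trans p0 pi)).
have : w \in (l :&: W)%VS by rewrite memv_cap wW wE memv_line.
rewrite capv_compl memv0 wE => /eqP /rowP /(_ ord0).
by rewrite !mxE !eqxx => /eqP; rewrite oner_eq0.
Qed.

Lemma diameter0 : diameter d 0 = 0%E.
Proof.
apply/eqP; rewrite eq_le diameter_ge0 andbT; apply: ge_ereal_sup => _ [[V W] [/= VG WG] <-].
have [_ deq _ _] := d_metric 0.
by rewrite lee_fin ((deq V W VG WG).2 (Gr0_unique VG WG)).
Qed.

(** Add to [V] and [U] a common subspace [X] orthogonal to both.  The projection of
    [V] on [U + X] is its projection on [U], so the [p] largest angles of [V + X]
    and [U + X] are at least those of [V] and [U]. *)
Lemma diameter_mono p q : (0 < p <= q)%N -> (diameter d p <= diameter d q)%E.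
Proof.
move=> p0q; have /andP[p0 pq] := p0q.
apply: ge_ereal_sup => _ [[V U] [/= VG UG] <-].
have [m [V0 [U0 [dV0 dU0 -> ->]]]] := Gr_common VG UG.
(* The ambient dimension is raised so that the orthogonal complement of V + U,
   where dim (V + U) <= 2p, has room for [X]. *)
pose n := (m + (p + q))%N.
have [V1 dV <-] := in_Gr_widen V0 (leq_addr (p + q) m : (m <= n)%N).
have [U1 dU <-] := in_Gr_widen U0 (leq_addr (p + q) m : (m <= n)%N).
rewrite dV0 in dV; rewrite dU0 in dU.
pose perp := orthov (@inner R k n) (V1 + U1).
have dperp : (\dim (V1 + U1) + \dim perp = n)%N.
  rewrite -dimv_disjoint_sum ?perp_cap0 //.
  have -> : (V1 + U1 + perp)%VS = fullv.
    by apply/eqP; rewrite eqEsubv subvf; apply/subvP => v _; apply: perp_add.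
  by rewrite dimvf /dim /= mul1n.
have [|X dX /andP[_ Xperp]] := @exists_intermediate_subspace R k n 0 perp (q - p) (sub0v _).
  have arith a b : (a + b = n -> a <= p + p -> q - p <= b)%N by rewrite /n; lia.
  have [le_2p _] := dimv_add_leqif V1 U1; rewrite dV dU in le_2p.
  by rewrite dimv0 /=; apply: arith dperp le_2p.
have XV x v : x \in X -> v \in (V1 + U1)%VS -> inner x v = 0.
  by move=> /(subvP Xperp) /mem_orthovP; apply.
have disjoint (Y : {vspace 'rV[F]_n}) : (Y <= V1 + U1)%VS -> (Y :&: X = 0)%VS.
  move=> YVU; apply/eqP; rewrite -subv0; apply/subvP => v; rewrite memv_cap memv0 -inner_eq0.
  by case/andP=> vY vX; rewrite XV // (subvP YVU).
have dV' : \dim (V1 + X) = q.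
  by rewrite dimv_disjoint_sum ?disjoint ?addvSl // dV dX subnKC.
have dU' : \dim (U1 + X) = q.
  by rewrite dimv_disjoint_sum ?disjoint ?addvSr // dU dX subnKC.
have V'G : Gr q (in_Gr (V1 + X)) by apply/Gr_in_Gr.
have U'G : Gr q (in_Gr (U1 + X)) by apply/Gr_in_Gr.
apply: le_trans (d_le_diameter V'G U'G); rewrite lee_fin.
rewrite (regular_angles p0) // (regular_angles (leq_trans p0 pq)) //.
apply: regular_le => //.
- by rewrite -dV; apply: angle_list_principal_angles; rewrite dV dU.
- by rewrite -dV'; apply: angle_list_principal_angles; rewrite dV' dU'.
move=> i ip; rewrite -{1}dV' -{1}dV; apply: principal_angles_le; rewrite ?dV' ?dV ?dU' ?dU //.
  exact: addvSl.
move=> v vV; suff -> : orthogonal_proj (U1 + X) v = orthogonal_proj U1 v by [].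
apply: orthogonal_proj_unique.
  by apply: (subvP (addvSl _ _)); apply: memv_orthogonal_proj.
move=> _ /memv_addP[u uU [x xX ->]]; rewrite innerDr orthogonal_projP // add0r.
apply: inner_eq0C; rewrite XV // memvB //; first exact: (subvP (addvSl _ _)).
by apply: (subvP (addvSr _ _)); apply: memv_orthogonal_proj.
Qed.

Lemma asym_dist_le_diameter n (V : {vspace 'rV[F]_n}) W :
  (asym_dist d (in_Gr V) W <= diameter d (\dim V))%E.
Proof. by rewrite /asym_dist Gr_dim_in_Gr; apply: inf_in_le. Qed.

Lemma asym_dist_ge0 n (V : {vspace 'rV[F]_n}) W : (0 <= asym_dist d (in_Gr V) W)%E.
Proof.
rewrite /asym_dist Gr_dim_in_Gr; apply: inf_in_ge0; first exact: diameter_ge0.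
move=> _ [U [UG _] <-]; have [d0 _ _ _] := d_metric (\dim V).
by rewrite lee_fin d0 //; apply/Gr_in_Gr.
Qed.

Lemma asym_dist_large n (V W : {vspace 'rV[F]_n}) : (\dim W < \dim V)%N ->
  asym_dist d (in_Gr V) (in_Gr W) = diameter d (\dim V).
Proof.
move=> WV; rewrite /asym_dist Gr_dim_in_Gr; set S := (X in inf_in _ X).
suff -> : S = set0 by apply/inf_in_set0/diameter_ge0.
apply/seteqP; split=> // x [U /Gr_sub_in_Gr [U0 [dU /dimvS UW _]] _].
by move: WV; rewrite ltnNge -dU UW.
Qed.

Lemma asym_dist_attained n (V W U : {vspace 'rV[F]_n}) p : \dim V = p -> \dim U = p ->
  (U <= W)%VS ->
  (forall U' : {vspace 'rV[F]_n}, \dim U' = p -> (U' <= W)%VS ->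
    d p (in_Gr V) (in_Gr U) <= d p (in_Gr V) (in_Gr U')) ->
  asym_dist d (in_Gr V) (in_Gr W) = (d p (in_Gr V) (in_Gr U))%:E.
Proof.
move=> dV dU UW Umin; rewrite /asym_dist Gr_dim_in_Gr dV.
have VG : Gr p (in_Gr V) by apply/Gr_in_Gr.
have UG : Gr p (in_Gr U) by apply/Gr_in_Gr.
have [d0 _ _ _] := d_metric p.
apply: inf_in_min.
- by exists (in_Gr U) => //; apply/Gr_sub_in_Gr; exists U.
- move=> _ [_ /Gr_sub_in_Gr [U' [dU' U'W ->]] <-].
  by rewrite lee_fin Umin.
- by rewrite lee_fin d0 // d_le_diameter.
Qed.

(** Projecting on a subspace of [W] instead of [W] shortens the images, hence
    enlarges the angles with [V]; on [W'] the images of [V] are the same. *)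
Lemma asym_dist_projection n p (V W W' : {vspace 'rV[F]_n}) :
  \dim V = p -> (0 < p <= \dim W)%N -> projection_subspaces W V W' ->
  asym_dist d (in_Gr V) (in_Gr W) = (d p (in_Gr V) (in_Gr W'))%:E /\
  d p (in_Gr V) (in_Gr W') = Phi p (principal_angles V W).
Proof.
move=> dV /andP[p0 pW] W'P; have leVW : (\dim V <= \dim W)%N by rewrite dV.
have [W'W dW' _] := W'P; rewrite (minn_idPl leVW) dV in dW'.
have dE : d p (in_Gr V) (in_Gr W') = Phi p (principal_angles V W).
  by rewrite (regular_angles p0) // (principal_angles_projection_subspace leVW W'P).
split=> //; apply: asym_dist_attained => // U dU UW.
rewrite dE (regular_angles p0) //.
have leVU : (\dim V <= \dim U)%N by rewrite dV dU.
apply: (nondecreasing_pointwise (regular_nondecreasing p0)).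
- by rewrite -dV; apply: angle_list_principal_angles.
- by rewrite -dV; apply: angle_list_principal_angles.
move=> i; have [iV|Vi] := ltnP i (\dim V).
  rewrite -[X in _ <= _`_X]add0n -(subnn (\dim V)); apply: principal_angles_le => //.
  by move=> v _; apply: orthogonal_proj_mono.
have [sU _ _] := angle_list_principal_angles leVU.
have [sW _ _] := angle_list_principal_angles leVW.
by rewrite !nth_default ?sU ?sW.
Qed.

Lemma asym_dist_self n (V W : {vspace 'rV[F]_n}) : (V <= W)%VS ->
  asym_dist d (in_Gr V) (in_Gr W) = 0%E.
Proof.
move=> VW; have VG : Gr (\dim V) (in_Gr V) by apply/Gr_in_Gr.
have [d0 deq _ _] := d_metric (\dim V).
have dV0 : d (\dim V) (in_Gr V) (in_Gr V) = 0 by apply/deq.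
rewrite (@asym_dist_attained n V W V (\dim V)) ?dV0 // => U dU _.
by rewrite d0 //; apply/Gr_in_Gr.
Qed.

Lemma asym_dist_dim0 n (V W : {vspace 'rV[F]_n}) : \dim V = 0%N ->
  asym_dist d (in_Gr V) (in_Gr W) = 0%E.
Proof. by move=> /eqP; rewrite dimv_eq0 => /eqP ->; apply/asym_dist_self/sub0v. Qed.

(** Were [W] of larger dimension, its distance to [V] would be a positive diameter. *)
Lemma asym_dist_eq0 n (V W : {vspace 'rV[F]_n}) : (\dim V <= \dim W)%N ->
  asym_dist d (in_Gr V) (in_Gr W) = 0%E -> asym_dist d (in_Gr W) (in_Gr V) = 0%E -> V = W.
Proof.
rewrite leq_eqVlt => /predU1P[dVW|ltVW] VW0 WV0; last first.
  have := diameter_gt0 (leq_ltn_trans (leq0n _) ltVW).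
  by rewrite -(asym_dist_large ltVW) WV0 ltxx.
have VG : Gr (\dim V) (in_Gr V) by apply/Gr_in_Gr.
have WG : Gr (\dim V) (in_Gr W) by apply/Gr_in_Gr.
apply: in_Gr_inj; have [V0|V_gt0] := posnP (\dim V).
  by rewrite V0 in VG WG; apply: Gr0_unique.
have [W' W'P] := exists_projection_subspace V W.
have [W'W dW' _] := W'P; rewrite dVW minnn in dW'.
have W'E : W' = W by apply/eqP; rewrite eqEdim W'W dW' /=.
have V_le : (0 < \dim V <= \dim W)%N by rewrite V_gt0 dVW /=.
have [+ _] := asym_dist_projection (erefl _) V_le W'P.
rewrite W'E VW0 => -[/esym dVW0]; have [_ deq _ _] := d_metric (\dim V).
exact/(deq _ _ VG WG).
Qed.

(** The angles of [V'] with [Z] are below the largest ones of [W] with [Z], by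
    interlacing. *)
Lemma asym_dist_subspace n p (V' W W' Z : {vspace 'rV[F]_n}) :
  \dim V' = p -> (0 < p <= \dim W)%N -> (V' <= W)%VS -> (\dim W <= \dim Z)%N ->
  projection_subspaces Z V' W' ->
  ((d p (in_Gr V') (in_Gr W'))%:E <= asym_dist d (in_Gr W) (in_Gr Z))%E.
Proof.
move=> dV' p0W V'W WZ W'P; have /andP[p0 pW] := p0W.
have pZ : (0 < p <= \dim Z)%N by rewrite p0 (leq_trans pW).
have WZ' : (0 < \dim W <= \dim Z)%N by rewrite WZ (leq_trans p0).
have [Z' Z'P] := exists_projection_subspace W Z.
have [-> ->] := asym_dist_projection (erefl _) WZ' Z'P.
have [_ ->] := asym_dist_projection dV' pZ W'P.
have leV'Z : (\dim V' <= \dim Z)%N by rewrite dV' (leq_trans pW).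
rewrite lee_fin; apply: regular_le => //.
- by rewrite -dV'; apply: angle_list_principal_angles.
- exact: angle_list_principal_angles.
by move=> i ip; rewrite -{1}dV'; apply: principal_angles_le => //; rewrite dV'.
Qed.

(** If a step goes to a smaller dimension its cost is a diameter, and diameters
    increase with the dimension.  Otherwise pass through a projection subspace of
    [W] and a projection subspace of that one in [Z]. *)
Lemma asym_dist_triangle n (V W Z : {vspace 'rV[F]_n}) :
  (asym_dist d (in_Gr V) (in_Gr Z) <=
   asym_dist d (in_Gr V) (in_Gr W) + asym_dist d (in_Gr W) (in_Gr Z))%E.
Proof.
have [V0|V_gt0] := posnP (\dim V).
  by rewrite asym_dist_dim0 // adde_ge0 ?asym_dist_ge0.
have [VW|WV] := leqP (\dim V) (\dim W); last first.
  rewrite (asym_dist_large WV); apply: le_trans (asym_dist_le_diameter _ _) _.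
  by rewrite leeDl ?asym_dist_ge0.
have [WZ|ZW] := leqP (\dim W) (\dim Z); last first.
  rewrite (asym_dist_large ZW); apply: le_trans (asym_dist_le_diameter _ _) _.
  apply: le_trans (leeDr _ (asym_dist_ge0 _ _)).
  by rewrite diameter_mono // V_gt0.
have [V' V'P] := exists_projection_subspace V W.
have [V'W dV' _] := V'P; rewrite (minn_idPl VW) in dV'.
have [W' W'P] := exists_projection_subspace V' Z.
have VZ := leq_trans VW WZ.
have [W'Z dW' _] := W'P; rewrite dV' (minn_idPl VZ) in dW'.
have [|-> _] := asym_dist_projection (erefl _) _ V'P; first by rewrite V_gt0.
have le_WZ : ((d (\dim V) (in_Gr V') (in_Gr W'))%:E <= asym_dist d (in_Gr W) (in_Gr Z))%E.
  by apply: asym_dist_subspace W'P; rewrite ?V_gt0.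
apply: le_trans (leeD2l _ le_WZ).
apply: (@le_trans _ _ (d (\dim V) (in_Gr V) (in_Gr W'))%:E); last first.
  have [_ _ _ tri] := d_metric (\dim V).
  by rewrite -EFinD lee_fin tri //; apply/Gr_in_Gr.
rewrite /asym_dist Gr_dim_in_Gr; apply: ge_ereal_sup => x [_]; apply.
by exists (in_Gr W') => //; apply/Gr_sub_in_Gr; exists W'.
Qed.

End RegularFamily.

Theorem theorem3p7 (R : realType) (k : base_field)
    (d : nat -> set (nat -> base_scalar R k) -> set (nat -> base_scalar R k) -> R)
    (Phi : nat -> seq R -> R) :
  regular_family d Phi ->
  asymmetric_metric_on (Gr_total R k) (asym_dist d) /\
  forall (n p q : nat) (V W W' : {vspace 'rV[base_scalar R k]_n}),
    \dim V = p -> \dim W = q -> projection_subspaces W V W' ->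
    asym_dist d (in_Gr V) (in_Gr W) = asym_dist d (in_Gr V) (in_Gr W') /\
    (if (0 < p <= q)%N then
       asym_dist d (in_Gr V) (in_Gr W') = (d p (in_Gr V) (in_Gr W'))%:E /\
       d p (in_Gr V) (in_Gr W') = Phi p (principal_angles V W)
     else asym_dist d (in_Gr V) (in_Gr W') = diameter d p).
Proof.
move=> dPhi; split.
  split=> [x y xG yG|x y xG yG|x y z xG yG zG].
  - have [n [V [W [_ [-> -> _]]]]] := Gr_total_common xG yG yG.
    exact: asym_dist_ge0 dPhi _ _ _.
  - have [n [V [W [_ [-> -> _]]]]] := Gr_total_common xG yG yG.
    split=> [[VW WV]|->]; last by split; apply: asym_dist_self dPhi _ _ _ (subvv _).
    congr (in_Gr _); have [le_VW|/ltnW le_WV] := leqP (\dim V) (\dim W).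
      exact: asym_dist_eq0 dPhi _ _ _ le_VW VW WV.
    exact/esym/(asym_dist_eq0 dPhi le_WV WV VW).
  - have [n [V [W [Z [-> -> ->]]]]] := Gr_total_common xG yG zG.
    exact: asym_dist_triangle dPhi _ _ _ _.
move=> n p q V W W' dV <- W'P; have [W'W dW' _] := W'P; rewrite dV in dW'.
case: ifP => [/andP[p0 pW]|].
  rewrite (minn_idPl pW) in dW'.
  have W'P' : projection_subspaces W' V W' by apply: projection_subspaces_self W'P; rewrite dV.
  have [|-> dE] := asym_dist_projection dPhi dV _ W'P; first by rewrite p0.
  have [|-> _] := asym_dist_projection dPhi dV _ W'P'; first by rewrite p0 dW' /=.
  by [].
have [p0 _|p0 /= /negbT] := posnP p.
  by rewrite !(asym_dist_dim0 dPhi) ?dV // p0 (diameter0 dPhi).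
rewrite -ltnNge => Wp; rewrite !(asym_dist_large dPhi) ?dV // dW'.
by rewrite gtn_min Wp orbT.
Qed.
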